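(* Let $X=\{X(t),t\in\mathbb{R}^N\}$ be a centered real-valued Gaussian random field with stationary increments and spectral density $f$. Suppose there are positive constants $c_1,c_2,c_3,\gamma$ and $(\beta_1,\dots,\beta_N)\in(0,\infty)^N$ with $\gamma>\sum_{j=1}^N\frac1{\beta_j}$ such that $$\frac{c_1}{\big(\sum_{j=1}^N|\lambda_j|^{\beta_j}\big)^{\gamma}}\le f(\lambda)\le\frac{c_2}{\big(\sum_{j=1}^N|\lambda_j|^{\beta_j}\big)^{\gamma}}\qquad\text{for all }\lambda\in\mathbb{R}^N\text{ with }|\lambda|\ge c_3 .$$ Then for every $j=1,\dots,N$ and every $t\in\mathbb{R}^N$, the mean square partial derivative $X'_j(t)$ exists if and only if $$\beta_j\Big(\gamma-\sum_{i=1}^N\frac1{\beta_i}\Big)>2,$$ or equivalently $H_j>1$, where $H_j=\frac{\beta_j}{2}\big(\gamma-\sum_{i=1}^N\frac1{\beta_i}\big)$.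
   Context: $X$ satisfies $X(0)=0$ and has a continuous covariance function given by $\mathbb{E}[X(s)X(t)]=\int_{\mathbb{R}^N}(e^{i\langle s,\lambda\rangle}-1)(e^{-i\langle t,\lambda\rangle}-1)f(\lambda)\,d\lambda$, where $f\ge0$ is an even measurable function with $\int_{\mathbb{R}^N}\frac{|\lambda|^2}{1+|\lambda|^2}f(\lambda)\,d\lambda<\infty$; $f$ is called the spectral density of $X$. The mean square partial derivative $X'_j(t)$ is the $L^2$-limit, as $h\to0$, of $\frac{X(t+he_j)-X(t)}{h}$, where $e_j$ is the $j$-th coordinate unit vector. *)

(* Defs.v *)
From HB Require Import structures.
From mathcomp Require Import all_boot all_order all_algebra.
From mathcomp Require Import all_classical all_reals all_analysis.
From mathcomp Require Import complex.

Set Implicit Arguments.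
Unset Strict Implicit.
Unset Printing Implicit Defensive.

Import Order.TTheory GRing.Theory Num.Def Num.Theory.
Import numFieldNormedType.Exports.

Local Open Scope classical_set_scope.
Local Open Scope ring_scope.

(* R^n is 'rV[R]_n with its library topology. The library gives it no
   measurable structure; we use the product sigma-algebra, generated by the
   coordinate maps. It is the Borel sigma-algebra of R^n. *)
Definition rV_display : measure_display.
Proof. exact. Qed.

Section measurable_rV.
Context {R : realType}.
Variable n : nat.

Let coord (i : 'I_n) (x : 'rV[R]_n) : measurableTypeR R := x 0 i.

Let rV_set0 : g_sigma_preimage coord set0.
Proof. exact: sigma_algebra0. Qed.

Let rV_setC A : g_sigma_preimage coord A -> g_sigma_preimage coord (~` A).
Proof. exact: sigma_algebraC. Qed.

Let rV_bigcup (F : _^nat) : (forall i, g_sigma_preimage coord (F i)) ->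
  g_sigma_preimage coord (\bigcup_i (F i)).
Proof. exact: sigma_algebra_bigcup. Qed.

HB.instance Definition _ := @isMeasurable.Build rV_display
  'rV[R]_n (g_sigma_preimage coord) rV_set0 rV_setC rV_bigcup.

Lemma measurable_coord (i : 'I_n) :
  measurable_fun [set: 'rV[R]_n] (fun x : 'rV[R]_n => x 0 i : measurableTypeR R).
Proof.
move=> _ Y mY; rewrite setTI; apply: sub_sigma_algebra => /=.
rewrite -bigcup_seq/=; exists i => /=; first by rewrite mem_index_enum.
by exists Y => //; rewrite setTI.
Qed.

Lemma measurable_fun_rVP d (T : measurableType d) (f : T -> 'rV[R]_n) :
  (forall i, measurable_fun [set: T] (fun t => f t 0 i : measurableTypeR R)) ->
  measurable_fun [set: T] f.
Proof.
move=> mf _ A mA; rewrite setTI.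
suff : measurable `<=` image_set_system setT f (@measurable _ T).
  by move=> /(_ _ mA); rewrite /image_set_system/= setTI.
apply: smallest_sub; first exact/sigma_algebra_image/sigma_algebra_measurable.
rewrite -bigcup_seq => B [i _ [C mC <-]].
rewrite /image_set_system/= !setTI.
by have := mf i measurableT C mC; rewrite setTI.
Qed.

End measurable_rV.

Section rV_cons.
Context {R : realType}.
Variable n : nat.

Definition rV_cons (p : measurableTypeR R * 'rV[R]_n) : 'rV[R]_n.+1 :=
  \row_i if unlift ord0 i is Some k then p.2 0 k else p.1.

Definition rV_uncons (x : 'rV[R]_n.+1) : measurableTypeR R * 'rV[R]_n :=
  (x 0 ord0, \row_i x 0 (lift ord0 i)).

Lemma rV_consK : cancel rV_cons rV_uncons.
Proof.
move=> [a x]; rewrite /rV_uncons !mxE unlift_none; congr (_, _).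
by apply/rowP => i; rewrite !mxE liftK.
Qed.

Lemma measurable_rV_cons : measurable_fun setT rV_cons.
Proof.
apply: measurable_fun_rVP => i; case: (unliftP ord0 i) => [k|] ->.
  rewrite [X in measurable_fun _ X](_ : _ =
      (fun x : 'rV[R]_n => x 0 k : measurableTypeR R) \o snd).
    exact: (measurableT_comp (measurable_coord k) measurable_snd).
  by apply/funext => p /=; rewrite mxE liftK.
rewrite [X in measurable_fun _ X](_ : _ = fst); first exact: measurable_fst.
by apply/funext => p /=; rewrite mxE unlift_none.
Qed.

Lemma measurable_rV_uncons : measurable_fun setT rV_uncons.
Proof.
rewrite /rV_uncons; apply: measurable_fun_pair; first exact: measurable_coord.
apply: measurable_fun_rVP => i; under eq_fun do rewrite mxE.
exact: measurable_coord.
Qed.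

End rV_cons.

Section lebesgue_rVS.
Context {R : realType}.
Variables (n : nat) (mu : {sigma_finite_measure set 'rV[R]_n -> \bar R}).

Definition lebesgue_rVS : set 'rV[R]_n.+1 -> \bar R :=
  pushforward (lebesgue_measure \x mu)%E (@rV_cons R n).

Let m : {measure set 'rV[R]_n.+1 -> \bar R} :=
  measure_function_pushforward__canonical__measure_function_Measure
    (lebesgue_measure \x mu)%E (@measurable_rV_cons R n).

Let lebesgue_rVS0 : lebesgue_rVS set0 = 0%E.
Proof. exact: (measure0 m). Qed.

Let lebesgue_rVS_ge0 A : (0 <= lebesgue_rVS A)%E.
Proof. exact: (measure_ge0 m). Qed.

Let lebesgue_rVS_sigma_additive : semi_sigma_additive lebesgue_rVS.
Proof. exact: (@measure_semi_sigma_additive _ _ _ m). Qed.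

HB.instance Definition _ := isMeasure.Build _ _ _ lebesgue_rVS
  lebesgue_rVS0 lebesgue_rVS_ge0 lebesgue_rVS_sigma_additive.

Let lebesgue_rVS_sigma_finite : sigma_finite setT lebesgue_rVS.
Proof.
have /sigma_finiteP[F [TF ndF Foo]] := sigma_finiteT (@lebesgue_measure R).
have /sigma_finiteP[G [TG ndG Goo]] := sigma_finiteT mu.
exists (fun i => @rV_uncons R n @^-1` (F i `*` G i)).
  rewrite -preimage_bigcup [X in _ @^-1` X](_ : _ = setT) ?preimage_setT//.
  apply/seteqP; split=> // -[a x] _.
  have [i _ Fia] : (\bigcup_i F i) a by rewrite -TF.
  have [k _ Gkx] : (\bigcup_i G i) x by rewrite -TG.
  exists (maxn i k) => //; split => /=.
    by move: a Fia; exact/subsetPset/ndF/leq_maxl.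
  by move: x Gkx; exact/subsetPset/ndG/leq_maxr.
move=> i; have [mFi Fioo] := Foo i; have [mGi Gioo] := Goo i.
have mFG : measurable (F i `*` G i) by exact: measurableX.
split; first by rewrite -[X in measurable X]setTI; exact: measurable_rV_uncons.
rewrite /lebesgue_rVS /pushforward -comp_preimage.
rewrite (_ : _ @^-1` _ = F i `*` G i); last first.
  have -> : @rV_uncons R n \o @rV_cons R n = id.
    by apply/funext => p; exact: rV_consK.
  by rewrite preimage_id.
by rewrite product_measure1E// lte_mul_pinfty// ge0_fin_numE.
Qed.

HB.instance Definition _ := Measure_isSigmaFinite.Build _ _ _
  lebesgue_rVS lebesgue_rVS_sigma_finite.

End lebesgue_rVS.

(* n-dimensional Lebesgue measure, as an iterated product of the library's
   one-dimensional one *)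
Fixpoint lebesgue_rV (R : realType) (n : nat) :
    {sigma_finite_measure set 'rV[R]_n -> \bar R} :=
  if n is k.+1 then lebesgue_rVS (lebesgue_rV R k) else \d_(0 : 'rV[R]_0).
Arguments lebesgue_rV : clear implicits.

(* lebesgue_rV is normalized as expected: the volume of a box *)
Lemma lebesgue_rV_box (R : realType) (n : nat) (A : 'I_n -> set R) :
  (forall i, measurable (A i : set (measurableTypeR R))) ->
  lebesgue_rV R n [set x : 'rV[R]_n | forall i, A i (x 0 i)] =
  (\prod_(i < n) lebesgue_measure (A i))%E.
Proof.
elim: n A => [|n IH] A mA.
  rewrite big_ord0 (_ : [set x | _] = setT) /= ?diracT//.
  by apply/seteqP; split=> // x _ [].
rewrite big_ord_recl -IH// -product_measure1E//; last first.
  rewrite [X in measurable X](_ : _ = \bigcap_(i in [set: 'I_n])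
      ((fun x : 'rV[R]_n => x 0 i : measurableTypeR R) @^-1` A (lift ord0 i))).
    apply: fin_bigcap_measurable => // i _.
    by rewrite -[X in measurable X]setTI; exact: measurable_coord.
  by apply/seteqP; split=> [x h i _|x h i]; exact: h.
rewrite /= /lebesgue_rVS /pushforward; congr (product_measure1 _ _ _).
apply/seteqP; split=> -[a x]/=.
  move=> h; split=> [|i].
    by have := h ord0; rewrite mxE unlift_none.
  by have := h (lift ord0 i); rewrite mxE liftK.
by move=> [ha hx] i; rewrite mxE; case: unliftP => [k|] ->.
Qed.

(* the library norm `|x| on 'rV[R]_n is the sup norm; this is the Euclidean
   one *)
Definition enorm (R : realType) (n : nat) (x : 'rV[R]_n) : R :=
  Num.sqrt (\sum_(i < n) x 0 i ^+ 2).

Definition dotrV (R : realType) (n : nat) (x y : 'rV[R]_n) : R :=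
  \sum_(i < n) x 0 i * y 0 i.

Section complex_valued.
Local Open Scope complex_scope.
Context {R : realType}.

Definition expi (x : R) : R[i] := cos x +i* sin x.

Definition cintegral d (T : measurableType d) (mu : {measure set T -> \bar R})
    (g : T -> R[i]) : R[i] :=
  (\int[mu]_x complex.Re (g x)) +i* (\int[mu]_x complex.Im (g x)).

End complex_valued.

Section random_fields.
Context {R : realType} {d : measure_display} {T : measurableType d}.
Variables (P : probability T R) (N : nat).
Implicit Types (X : 'rV[R]_N -> {RV P >-> R}) (f : 'rV[R]_N -> R).

(* possibly degenerate: normal_prob m 0 is not the point mass at m *)
Definition gaussian_law (m s : R) (A : set R) : \bar R :=
  if s == 0 then \d_m A else normal_prob m s A.

Definition gaussian_rv (Y : T -> R) : Prop :=
  exists m s : R, forall A : set (measurableTypeR R), measurable A ->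
    P (Y @^-1` A) = gaussian_law m s A.

(* all finite-dimensional distributions are Gaussian: every linear combination
   of coordinates is a Gaussian variable *)
Definition gaussian_field X : Prop :=
  forall (n : nat) (t : 'I_n -> 'rV[R]_N) (a : 'I_n -> R),
    gaussian_rv (fun w => \sum_(k < n) a k * X (t k) w).

Definition centered X : Prop := forall t, ('E_P[X t] = 0)%E.

(* equality of all finite-dimensional distributions of the fields
   t |-> X (t + h) - X h and t |-> X t - X 0 *)
Definition stationary_increments X : Prop :=
  forall (h : 'rV[R]_N) (n : nat) (t : 'I_n -> 'rV[R]_N) (A : set 'rV[R]_n),
    measurable A ->
    P [set w | A (\row_k (X (t k + h) w - X h w))] =
    P [set w | A (\row_k (X (t k) w - X 0 w))].

(* for a centered field; the expectation of a product of two Gaussian variables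
   is finite, so that fine loses nothing *)
Definition covariance_function X (s t : 'rV[R]_N) : R :=
  fine ('E_P[fun w => (X s w * X t w)%R])%E.

Definition continuous_covariance X : Prop :=
  continuous (fun st : 'rV[R]_N * 'rV[R]_N => covariance_function X st.1 st.2).

(* the integral of the covariance formula converges absolutely, by the
   integrability condition on f and the bound
   |(e^{i<s,x>} - 1)(e^{-i<t,x>} - 1)| <= C |x|^2 / (1 + |x|^2) *)
Definition spectral_density X f : Prop :=
  [/\ forall x, 0 <= f x,
      forall x, f (- x) = f x,
      measurable_fun [set: 'rV[R]_N] f,
      (\int[lebesgue_rV R N]_x
         (enorm x ^+ 2 / (1 + enorm x ^+ 2) * f x)%:E < +oo)%E &
      forall s t, (covariance_function X s t)%:C%C =
        cintegral (lebesgue_rV R N) (fun x =>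
          (expi (dotrV s x) - 1) * (expi (- dotrV t x) - 1) * (f x)%:C%C)].

Definition is_ms_partial X (j : 'I_N) (t : 'rV[R]_N) (Y : {RV P >-> R}) : Prop :=
  (Y : T -> R) \in Lfun P 2%:E /\
  Lnorm P 2%:E (fun w =>
      ((X (t + h *: delta_mx 0 j) w - X t w) / h - Y w)%:E)
    @[h --> (0 : R)^'] --> 0%E.

Definition ms_partial_exists X (j : 'I_N) (t : 'rV[R]_N) : Prop :=
  exists Y : {RV P >-> R}, is_ms_partial X j t Y.

End random_fields.

Section anisotropy.
Context {R : realType}.
Variables (N : nat) (beta : 'I_N -> R) (gamma : R).

Definition aniso_power (x : 'rV[R]_N) : R :=
  (\sum_(j < N) `|x 0 j| `^ beta j) `^ gamma.

Definition hurst_index (j : 'I_N) : R :=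
  beta j / 2 * (gamma - \sum_(i < N) (beta i)^-1).

End anisotropy.

(* Main.v *)
Require Import Defs.
From mathcomp Require Import all_boot all_order all_algebra.
From mathcomp Require Import all_classical all_reals all_analysis.
From mathcomp Require Import measurable_realfun ring lra.

(* The map X(t) -> e^{i<t,.>} - 1 is an isometry from the span of X in L^2(P)
   into L^2(f), so the difference quotients of X in direction j correspond to
   those of e^{i<t,x>}. The latter are bounded by |x_j| and tend to
   i x_j e^{i<t,x>}; by dominated convergence and completeness of L^2, and
   conversely by Fatou, X'_j(t) exists iff x_j^2 f is integrable. To decide
   this, cut R^N along the boxes |x_i| <= e^{k/beta_i}: on the k-th shell f is of
   order e^{-k gamma}, x_j^2 is at most e^{2k/beta_j} (and of that order on a
   fixed proportion), and the volume is of order e^{k sum_i 1/beta_i}, so the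
   integral behaves like a geometric series of ratio
   e^{2/beta_j + sum_i 1/beta_i - gamma}. *)

Set Implicit Arguments.
Unset Strict Implicit.
Unset Printing Implicit Defensive.

Import Order.TTheory GRing.Theory Num.Def Num.Theory.
Import numFieldNormedType.Exports.

Local Open Scope classical_set_scope.
Local Open Scope ring_scope.

(** * Square-integrable functions *)

(** Fatou's lemma for an almost everywhere limit, with bounds [c n] that converge; it serves both
    the completeness of L^2 and the passage from differentiability back to the moment. *)
Lemma fatou_ae_cvg d (T : measurableType d) (R : realType)
    (mu : {measure set T -> \bar R}) (g : nat -> T -> \bar R) (h : T -> \bar R)
    (c : nat -> \bar R) (l : \bar R) :
  (forall n, measurable_fun setT (g n)) -> (forall n x, 0 <= g n x)%E ->
  measurable_fun setT h -> (forall x, 0 <= h x)%E ->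
  {ae mu, forall x, g n x @[n --> \oo] --> h x} ->
  (forall n, \int[mu]_x g n x <= c n)%E -> c @ \oo --> l ->
  (\int[mu]_x h x <= l)%E.
Proof.
move=> mg g0 mh h0 gh gc cl.
have einf0 x : (0 <= limn_einf (g^~ x))%E.
  rewrite limn_einf_lim; apply: lime_ge; first exact: is_cvg_einfs.
  by apply: nearW => n; apply: le_ereal_inf_tmp => _ [k _ <-].
have -> : (\int[mu]_x h x = \int[mu]_x limn_einf (g^~ x))%E.
  apply: ge0_ae_eq_integral => //.
    apply: measurableT_comp => //.
    by apply: (@measurable_fun_limn_esup _ _ _ _ (fun n x => - g n x)%E) => n;
      exact: measurableT_comp.
  by apply: filterS gh => x ghx _; rewrite (cvg_limn_einf_sup ghx).1.
apply: (le_trans (fatou _ _ _ _)) => //.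
rewrite limn_einf_lim -(cvg_lim _ cl)//; apply: lee_lim.
- exact: is_cvg_einfs.
- by apply/cvg_ex; exists l.
apply: nearW => n; apply: le_trans (gc n).
by apply: ereal_inf_lbound; exists n => /=.
Qed.

Lemma ler_sqr_norm (R : realDomainType) (u v : R) :
  (u ^+ 2 <= v ^+ 2) = (`|u| <= `|v|).
Proof.
rewrite -real_normK ?num_real// -[v ^+ 2]real_normK ?num_real//.
by rewrite ler_sqr ?nnegrE.
Qed.

(** After multiplication by a, this follows from (a|x| - 1/2)^2 >= 0. *)
Lemma norm_le_scaled_sqrD (R : realFieldType) (a x : R) : 0 < a ->
  `|x| <= a * x ^+ 2 + a^-1.
Proof.
move=> a0; rewrite -real_normK ?num_real//.
move: (normr_ge0 x); move: `|x| => y y0.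
rewrite -(ler_pM2l a0) mulrDr mulfV ?gt_eqF//.
have : 0 <= (a * y - 1 / 2) ^+ 2 by exact: sqr_ge0.
by nra.
Qed.

(* Since |u| <= 2^n u^2 + 2^-n, the sum of the |D (n+1) - D n| is integrable. *)
Lemma ae_cvg_of_fast_L2_cauchy d (T : measurableType d) (R : realType)
    (P : probability T R) (D : nat -> T -> R) :
  (forall n, measurable_fun setT (D n)) ->
  (forall n, \int[P]_x ((D n.+1 x - D n x) ^+ 2)%:E <= ((4^-1) ^+ n)%:E)%E ->
  {ae P, forall x, cvgn (D ^~ x)}.
Proof.
move=> mD D4.
pose u n x : R := `|D n.+1 x - D n x|.
have mu_ n : measurable_fun setT (fun x => (u n x)%:E).
  apply/measurable_EFinP/measurableT_comp => //; exact: measurable_funB.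
(* With a = 2^n the bound is 2^n 4^-n + 2^-n, written in the form that [epsilon_trick0] sums. *)
have u2n n : (\int[P]_x (u n x)%:E <= (4 / (2 ^ n.+1)%:R)%:E)%E.
  have mB : measurable_fun setT (fun x => ((D n.+1 x - D n x) ^+ 2)%:E).
    by apply/measurable_EFinP/measurable_funX/measurable_funB.
  apply: (@le_trans _ _ (\int[P]_x ((2 ^+ n)%:E * ((D n.+1 x - D n x) ^+ 2)%:E +
      cst ((2 ^+ n)^-1)%:E x))%E).
    apply: ge0_le_integral => //.
      by move=> x _; rewrite lee_fin normr_ge0.
      by apply: emeasurable_funD => //; apply: measurable_funeM.
    move=> x _; rewrite -EFinM -EFinD lee_fin; apply: norm_le_scaled_sqrD.
    by rewrite exprn_gt0.
  rewrite ge0_integralD//; last first.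
  - by move=> x _; rewrite lee_fin invr_ge0 exprn_ge0.
  - by apply: measurable_funeM.
  - by move=> x _; rewrite lee_fin mulr_ge0 ?sqr_ge0 ?exprn_ge0.
  rewrite ge0_integralZl//; last first.
    by move=> x _; rewrite lee_fin sqr_ge0.
  rewrite integral_cst//.
  rewrite [X in (_ + _ * X)%E]probability_setT mule1.
  have -> : (4 / (2 ^ n.+1)%:R = 2 ^+ n * (4^-1) ^+ n + (2 ^+ n)^-1 :> R).
    rewrite -exprMn natrX exprS.
    have -> : 2 * 4^-1 = 2^-1 :> R by lra.
    by rewrite exprVn; field; rewrite expf_neq0.
  rewrite EFinD; apply: leeD => //; rewrite EFinM.
  by apply: lee_wpmul2l => //; rewrite lee_fin exprn_ge0.
have Soo : P.-integrable setT (fun x => \sum_(0 <= n <oo) (u n x)%:E)%E.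
  apply/integrableP; split.
    apply: (@ge0_emeasurable_sum _ _ _ _ (fun n x => (u n x)%:E) xpredT) => //.
    by move=> n x _ _; rewrite lee_fin normr_ge0.
  under eq_integral.
    move=> x _; rewrite gee0_abs; last first.
      by apply: nneseries_ge0 => n _ _; rewrite lee_fin normr_ge0.
    over.
  rewrite integral_nneseries//; last by move=> n x _; rewrite lee_fin normr_ge0.
  apply: (@le_lt_trans _ _ (4%:E)); last exact: ltry.
  apply: le_trans (epsilon_trick0 xpredT _) => //.
  by apply: lee_nneseries => // n _ _; apply: integral_ge0 => x _;
    rewrite lee_fin normr_ge0.
(* Almost everywhere the telescoping series converges absolutely, hence [D n x] converges. *)
have := integrable_ae measurableT Soo; apply: filterS => x /(_ I) Sx.
have /normed_cvg : cvgn [normed series (telescope (D^~ x))].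
  apply: nnseries_is_cvg => [n|]; first exact: normr_ge0.
  by rewrite ltey_eq Sx.
move=> /cvg_ex[l tl]; apply/cvg_ex; exists (D 0%N x + l).
rewrite [X in X @ _](_ : _ = (fun n => D 0%N x + series (telescope (D^~ x)) n)).
  by apply: cvgD => //; exact: cvg_cst.
by apply/funext => n; rewrite -eq_sum_telescope.
Qed.

(** Nonnegative values below a real [e] are finite, so smallness alone carries the finiteness that
    convergence to 0 in the extended reals includes. *)
Lemma ge0_cvge0P (R : realType) (I : Type) (F : set_system I) {FF : Filter F}
    (f : I -> \bar R) : (forall i, 0 <= f i)%E ->
  f @ F --> 0%E <-> forall e : R, 0 < e -> \forall i \near F, (f i < e%:E)%E.
Proof.
move=> f0; split=> [/fine_cvgP[ffin fcvg] e e0|fe].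
  apply: filterS2 ffin (cvgr_lt _ fcvg _ e0) => i fi /=.
  by rewrite -lte_fin fineK.
have f0fine i e : (f i < e%:E)%E -> f i = (fine (f i))%:E.
  by move=> fie; rewrite fineK// ge0_fin_numE// (lt_trans fie) ?ltry.
apply/fine_cvgP; split.
  by apply: filterS (fe _ ltr01) => i /f0fine ->.
apply/cvgrPdist_lt => e /fe; apply: filterS => i fie /=.
by rewrite sub0r normrN ger0_norm ?fine_ge0// -lte_fin -(f0fine _ _ fie).
Qed.

(* [Y] is the almost sure limit along a sequence [h n] with [delta (h n)] of
   order 4^-n; the bound then follows from Fatou's lemma. *)
Lemma L2_complete_dnbhs d (T : measurableType d) (R : realType)
    (P : probability T R) (D : R -> T -> R) (delta : R -> \bar R) :
  (forall h, measurable_fun setT (D h)) ->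
  (forall h, 0 <= delta h)%E -> delta h @[h --> 0^'] --> 0%E ->
  (forall h k, h != 0 -> k != 0 ->
    (\int[P]_x ((D h x - D k x) ^+ 2)%:E <= delta h + delta k)%E) ->
  exists Y : {RV P >-> R}, forall h, h != 0 ->
    (\int[P]_x ((D h x - Y x) ^+ 2)%:E <= delta h)%E.
Proof.
move=> mD delta_ge0 delta0 Ddelta.
(* The factor 1/2 leaves room within 4^-n for two errors, those of [h n] and [h n.+1]. *)
have ex_h n : exists h, h != 0 /\ (delta h <= (4^-1 ^+ n / 2)%:E)%E.
  have e0 : (0 < 4^-1 ^+ n / 2 :> R) by rewrite divr_gt0 ?exprn_gt0.
  have /filter_ex[h []] : \forall h \near (0 : R)^', h != 0 /\
      (delta h <= (4^-1 ^+ n / 2)%:E)%E.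
    near=> h; split; first by near: h; exact: nbhs_dnbhs_neq.
    by apply/ltW; near: h; exact: (ge0_cvge0P _).1.
  by exists h.
have [h /all_and2[hn0 hdelta]] := choice ex_h.
have half4 n : (4^-1 ^+ n / 2 <= 4^-1 ^+ n :> R).
  by rewrite ler_pdivrMr// ler_peMr ?exprn_ge0 ?ler1n.
have cvD : {ae P, forall x, cvgn (fun n => D (h n) x)}.
  apply: ae_cvg_of_fast_L2_cauchy => // n; apply: (le_trans (Ddelta _ _ _ _)) => //.
  rewrite [in leRHS](splitr (4^-1 ^+ n)) EFinD; apply: leeD => //.
  apply: (le_trans (hdelta _)); rewrite lee_fin ler_pM2r ?invr_gt0//.
  by rewrite exprS ler_piMl ?exprn_ge0// invf_le1 ?ler1n.
(* A limsup is measurable everywhere; its value matters only where [D (h n) x] converges, that is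
   almost surely. *)
pose y x := fine (limn_esup (fun n => (D (h n) x)%:E)).
have my : measurable_fun setT y.
  apply: (measurableT_comp (fine_measurable measurableT)).
  by apply: measurable_fun_limn_esup => n; exact/measurable_EFinP.
exists (mfun_Sub (mem_set my)) => k k0.
(* Fatou in [n] for fixed [k]: the bound [delta k] + 4^-n tends to [delta k]. *)
apply: (@fatou_ae_cvg _ _ _ _ (fun n x => ((D k x - D (h n) x) ^+ 2)%:E) _
    (fun n => delta k + (4^-1 ^+ n)%:E)%E) => //.
- by move=> n; apply/measurable_EFinP/measurable_funX/measurable_funB.
- by move=> n x; rewrite lee_fin sqr_ge0.
- by apply/measurable_EFinP/measurable_funX/measurable_funB.
- by move=> x; rewrite lee_fin sqr_ge0.
- apply: filterS cvD => x /cvg_ex[l Dl].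
  have -> : mfun_Sub (mem_set my) x = l.
    rewrite /= /y (_ : limn_esup _ = l%:E)//.
    by have /cvg_limn_einf_sup[] : (fun n => (D (h n) x)%:E) @ \oo --> l%:E
      by (apply: cvg_EFin; [exact: nearW|exact: Dl]).
  apply: cvg_EFin; first exact: nearW.
  by rewrite expr2; apply: cvgM; apply: cvgB => //; exact: cvg_cst.
- move=> n; apply: (le_trans (Ddelta _ _ _ _)) => //.
  by apply: leeD => //; apply: (le_trans (hdelta _)); rewrite lee_fin.
rewrite -[X in _ --> X]adde0; apply: cvgeD => //.
  by rewrite fin_num_adde_defl.
  exact: cvg_cst.
apply: cvg_EFin; first exact: nearW.
by apply: cvg_expr; rewrite ger0_norm ?invr_ge0// invf_lt1 ?ltr1n.
Unshelve. all: by end_near. Qed.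

Lemma Lnorm2_sqr d (T : measurableType d) (R : realType)
    (mu : {measure set T -> \bar R}) (f : T -> R) :
  (Lnorm mu 2%:E (EFin \o f) `^ 2 = \int[mu]_x (f x ^+ 2)%:E)%E.
Proof.
rewrite poweR_Lnorm//; apply: eq_integral => x _.
by rewrite /= powR_mulrn// real_normK ?num_real.
Qed.

Lemma Lfun2_of_sqr_lty d (T : measurableType d) (R : realType)
    (mu : {measure set T -> \bar R}) (f : T -> R) : measurable_fun setT f ->
  (\int[mu]_x (f x ^+ 2)%:E < +oo)%E -> f \in Lfun mu 2%:E.
Proof.
move=> mf; rewrite -Lnorm2_sqr => f2; rewrite inE; apply/andP; split.
  by rewrite inE.
by rewrite inE /= /finite_norm (lty_poweRy _ f2).
Qed.

Lemma lt_sqr_poweR (R : realType) (x : \bar R) (e : R) : (0 <= x)%E -> 0 < e ->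
  (x `^ 2 < (e ^+ 2)%:E)%E = (x < e%:E)%E.
Proof.
move=> + e0; case: x => [x| |]//= x0; last by rewrite pnatr_eq0.
by rewrite lte_fin powR_mulrn// ltr_sqr ?nnegrE// ltW.
Qed.

(** Squaring is monotone on nonnegative values: the threshold [e] is traded for its square root in
    one direction and for its square in the other. *)
Lemma Lnorm2_cvg0 d (T : measurableType d) (R : realType)
    (mu : {measure set T -> \bar R}) (I : Type) (F : set_system I) {FF : Filter F}
    (g : I -> T -> R) :
  Lnorm mu 2%:E (fun w => (g i w)%:E) @[i --> F] --> 0%E <->
  (\int[mu]_w (g i w ^+ 2)%:E)%E @[i --> F] --> 0%E.
Proof.
have int_ge0 i : (0 <= \int[mu]_w (g i w ^+ 2)%:E)%E.
  by apply: integral_ge0 => w _; rewrite lee_fin sqr_ge0.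
split=> [/(ge0_cvge0P (fun=> Lnorm_ge0 _ _ _)) cvg0|/(ge0_cvge0P int_ge0) cvg0].
- apply/(ge0_cvge0P int_ge0) => e e0.
  have s0 : 0 < Num.sqrt e by rewrite sqrtr_gt0.
  apply: filterS (cvg0 _ s0) => i.
  by rewrite -lt_sqr_poweR ?Lnorm_ge0// Lnorm2_sqr sqr_sqrtr// ltW.
- apply/(ge0_cvge0P (fun=> Lnorm_ge0 _ _ _)) => e e0.
  apply: filterS (cvg0 _ (exprn_gt0 2 e0)) => i.
  by rewrite -Lnorm2_sqr lt_sqr_poweR// Lnorm_ge0.
Qed.

(** * Gaussian variables are square integrable *)

(** [normal_pdf] and the Radon-Nikodym derivative have equal integrals over every measurable set, so
    they agree almost everywhere. *)
Lemma ge0_integral_normal_prob (R : realType) (m s : R) (f : R -> \bar R) :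
  (forall x, 0 <= f x)%E -> measurable_fun setT (f : measurableTypeR R -> \bar R) ->
  (\int[normal_prob m s]_x f x =
   \int[lebesgue_measure]_x (f x * (normal_pdf m s x)%:E))%E.
Proof.
move=> f0 mf.
rewrite -(Radon_Nikodym_SigmaFinite.change_of_variables
  (normal_prob_dominates m s) f0 measurableT mf).
have iRN := Radon_Nikodym_SigmaFinite.f_integrable (normal_prob_dominates m s).
apply: ae_eq_integral => //.
- by apply: emeasurable_funM => //; exact: (measurable_int _ iRN).
- by apply: emeasurable_funM => //; apply/measurable_EFinP; exact: measurable_normal_pdf.
apply: ae_eqe_mul2l; apply: integral_ae_eq => //.
  by apply/measurable_EFinP; exact: measurable_normal_pdf.
move=> E _ mE.
by rewrite -(Radon_Nikodym_SigmaFinite.f_integral (normal_prob_dominates m s)).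
Qed.

Lemma normal_prob_sqr_lty (R : realType) (m s : R) : s != 0 ->
  (\int[normal_prob m s]_x (x ^+ 2)%:E < +oo)%E.
Proof.
move=> s0.
have msqr : measurable_fun setT (fun x : measurableTypeR R => (x ^+ 2)%:E).
  by apply/measurable_EFinP; exact: measurable_funX.
rewrite ge0_integral_normal_prob//; last by move=> x; rewrite lee_fin sqr_ge0.
(* x^2 times the density is dominated by the density of deviation 2 s *)
pose r := 2 * s.
have r0 : r != 0 by rewrite mulf_neq0.
pose C := (2 * m ^+ 2 + 16 * s ^+ 2) * (normal_peak s / normal_peak r).
have C0 : 0 <= C.
  rewrite mulr_ge0 ?divr_ge0 ?normal_peak_ge0//.
  by have := sqr_ge0 m; have := sqr_ge0 s; lra.
apply: (@le_lt_trans _ _ (\int[lebesgue_measure]_x (C%:E * (normal_pdf m r x)%:E))%E).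
  apply: ge0_le_integral => //.
  - by move=> x _; rewrite -EFinM lee_fin mulr_ge0 ?sqr_ge0 ?normal_pdf_ge0.
  - apply: emeasurable_funM => //; apply/measurable_EFinP.
    exact: measurable_normal_pdf.
  - by apply: measurable_funeM; apply/measurable_EFinP; exact: measurable_normal_pdf.
  move=> x _; rewrite -!EFinM lee_fin !normal_pdfE//.
  (* The wide density has the factor e^{-u} and the narrow one e^{-4u}, so it is enough to bound x^2
     by a multiple of e^u. *)
  pose u := (x - m) ^+ 2 / (8 * s ^+ 2).
  have u0 : 0 <= u by apply: divr_ge0; rewrite ?sqr_ge0// mulr_ge0 ?sqr_ge0.
  have -> : normal_fun m s x = expR (- u * 4).
    by rewrite /normal_fun /u; congr expR; field.
  have -> : normal_fun m r x = expR (- u).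
    by rewrite /normal_fun /u /r; congr expR; field.
  have x2 : x ^+ 2 <= (2 * m ^+ 2 + 16 * s ^+ 2) * expR u.
    (* The bound is 2 m^2 + 2 (x - m)^2, whose excess over x^2 is (x - 2m)^2. *)
    have : x ^+ 2 <= 2 * m ^+ 2 + 16 * s ^+ 2 * u.
      have -> : 16 * s ^+ 2 * u = 2 * (x - m) ^+ 2 by rewrite /u; field.
      by have := sqr_ge0 (x - 2 * m); nra.
    move=> /le_trans; apply.
    apply: (@le_trans _ _ ((2 * m ^+ 2 + 16 * s ^+ 2) * (1 + u))).
      by have := sqr_ge0 m; have := sqr_ge0 s; nra.
    rewrite ler_wpM2l ?expR_ge1Dx//.
    by have := sqr_ge0 m; have := sqr_ge0 s; lra.
  have -> : C * (normal_peak r * expR (- u)) =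
      normal_peak s * ((2 * m ^+ 2 + 16 * s ^+ 2) * expR (- u)).
    by rewrite /C; field; rewrite gt_eqF ?normal_peak_gt0.
  rewrite mulrCA ler_wpM2l ?normal_peak_ge0//.
  apply: (le_trans (ler_wpM2r (expR_ge0 _) x2)).
  rewrite -mulrA -expRD ler_wpM2l//.
    by have := sqr_ge0 m; have := sqr_ge0 s; lra.
  by rewrite ler_expR; lra.
rewrite ge0_integralZl//.
- by rewrite integral_normal_pdf mule1 ltry.
- by apply/measurable_EFinP; exact: measurable_normal_pdf.
- by move=> x _; rewrite lee_fin normal_pdf_ge0.
Qed.

(** The second moment depends only on the law of [Y], a point mass if s = 0 and a normal law
    otherwise. *)
Lemma gaussian_rv_sqr_lty (R : realType) d (T : measurableType d)
    (P : probability T R) (Y : {RV P >-> R}) :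
  gaussian_rv P Y -> (\int[P]_x (Y x ^+ 2)%:E < +oo)%E.
Proof.
move=> [m [s Ylaw]].
have msqr : measurable_fun setT (fun x : measurableTypeR R => (x ^+ 2)%:E).
  by apply/measurable_EFinP; exact: measurable_funX.
(* [normal_prob] and the target of [Y] carry different displays *)
pose Y' : T -> measurableTypeR R := Y.
have mY : measurable_fun setT Y' by exact: (measurable_funPT Y).
pose law : {measure set (measurableTypeR R) -> \bar R} :=
  measure_function_pushforward__canonical__measure_function_Measure P mY.
have -> : (\int[P]_x (Y x ^+ 2)%:E = \int[law]_x (x ^+ 2)%:E)%E.
  by rewrite ge0_integral_pushforward// => x _; rewrite lee_fin sqr_ge0.
have [s0|s0] := eqVneq s 0.
  rewrite (@eq_measure_integral _ _ _ _ (\d_(m : measurableTypeR R))) => [|A mA _].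
    by rewrite integral_dirac// diracT mul1e ltry.
  by have := Ylaw A mA; rewrite /gaussian_law s0 eqxx.
rewrite (@eq_measure_integral _ _ _ _ (normal_prob m s)) => [|A mA _].
  exact: normal_prob_sqr_lty.
by have := Ylaw A mA; rewrite /gaussian_law (negbTE s0).
Qed.

(** * The spectral isometry *)

(** A linear combination is coded as a list of pairs of a coefficient and an index. This integrates
    the quadratic forms on both sides of the isometry. *)
Lemma integral_sum_mul d (T : measurableType d) (R : realType)
    (mu : {measure set T -> \bar R}) (I : Type) (s : seq (R * I))
    (G : I -> I -> T -> R) :
  (forall k l, mu.-integrable setT (EFin \o G k l)) ->
  (\int[mu]_x (\sum_(p <- s) \sum_(q <- s) p.1 * q.1 * G p.2 q.2 x)%:E =
   (\sum_(p <- s) \sum_(q <- s) p.1 * q.1 * \int[mu]_x G p.2 q.2 x)%:E)%E.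
Proof.
move=> iG.
have iZ (p q : R * I) :
    mu.-integrable setT (fun x => (p.1 * q.1 * G p.2 q.2 x)%:E).
  under eq_fun do rewrite EFinM.
  by apply: integrableZl => //; exact: iG.
have iS (p : R * I) :
    mu.-integrable setT (fun x => \sum_(q <- s) (p.1 * q.1 * G p.2 q.2 x)%:E)%E.
  exact: integrable_sum.
under eq_integral do (rewrite -sumEFin; under eq_bigr do rewrite -sumEFin).
rewrite integral_sum// -sumEFin; apply: eq_bigr => p _.
rewrite integral_sum// -sumEFin; apply: eq_bigr => q _.
under eq_integral do rewrite EFinM.
rewrite integralZl//; last exact: iG.
rewrite [RHS]EFinM /Rintegral fineK//.
by apply: integrable_fin_num => //; exact: iG.
Qed.

Lemma sqr_sum_mul (R : comPzRingType) (I : Type) (s : seq (R * I)) (g : I -> R) :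
  (\sum_(p <- s) p.1 * g p.2) ^+ 2 =
  \sum_(p <- s) \sum_(q <- s) p.1 * q.1 * (g p.2 * g q.2).
Proof.
rewrite expr2 big_distrlr; apply: eq_bigr => p _; apply: eq_bigr => q _.
by rewrite mulrACA.
Qed.

Lemma lipschitz_of_is_derive (R : realType) (g dg : R -> R) (a b : R) :
  (forall x : R, is_derive x 1 g (dg x)) -> (forall x, `|dg x| <= 1) ->
  `|g b - g a| <= `|b - a|.
Proof.
move=> gdg dg1; wlog ab : a b / a <= b => [H|].
  have [|/ltW ba] := leP a b; first exact: H.
  by rewrite distrC (distrC b); exact: H.
have gcont : {within `[a, b], continuous g}.
  apply: continuous_subspaceT => x; apply: differentiable_continuous.
  by apply/derivable1_diffP; case: (gdg x).
have [c _ ->] := MVT_segment ab (fun x _ => gdg x) gcont.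
by rewrite normrM ler_piMl.
Qed.

Lemma norm_cos_sub_le (R : realType) (a b : R) : `|cos b - cos a| <= `|b - a|.
Proof.
apply: (@lipschitz_of_is_derive _ cos (fun x => - sin x)) => x.
by rewrite normrN sin_max.
Qed.

Lemma norm_sin_sub_le (R : realType) (a b : R) : `|sin b - sin a| <= `|b - a|.
Proof. by apply: (@lipschitz_of_is_derive _ sin cos) => x; exact: cos_max. Qed.

Lemma norm_coord_le_enorm (R : realType) n (x : 'rV[R]_n) j : `|x 0 j| <= enorm x.
Proof.
rewrite -sqrtr_sqr /enorm ler_wsqrtr// (bigD1 j)//= lerDl sumr_ge0// => i _.
exact: sqr_ge0.
Qed.

Lemma norm_dotrV_le (R : realType) n (s x : 'rV[R]_n) :
  `|dotrV s x| <= (\sum_(i < n) `|s 0 i|) * enorm x.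
Proof.
rewrite /dotrV mulr_suml; apply: (le_trans (ler_norm_sum _ _ _)).
by apply: ler_sum => i _; rewrite normrM ler_wpM2l ?norm_coord_le_enorm.
Qed.

(** |e^{i<s,x>} - 1|^2 is at most 2 <s,x>^2 <= 2 K^2 |x|^2, and at most 4. The first bound plus
    |x|^2 times the second gives the estimate cleared of the denominator 1 + |x|^2. *)
Lemma sqr_expi_sub1_le (R : realType) n (s x : 'rV[R]_n) :
  (cos (dotrV s x) - 1) ^+ 2 + sin (dotrV s x) ^+ 2 <=
  (4 + 2 * (\sum_(i < n) `|s 0 i|) ^+ 2) * (enorm x ^+ 2 / (1 + enorm x ^+ 2)).
Proof.
set K := \sum_(i < n) `|s 0 i|; set a := dotrV s x; set q := enorm x ^+ 2.
have q0 : 0 <= q by exact: sqr_ge0.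
have aq : a ^+ 2 <= K ^+ 2 * q.
  rewrite -exprMn ler_sqr_norm (le_trans (norm_dotrV_le _ _))//.
  exact: ler_norm.
rewrite mulrA ler_pdivlMr ?ltr_pwDl// mulrDr mulr1.
have le2a : (cos a - 1) ^+ 2 + sin a ^+ 2 <= 2 * a ^+ 2.
  have := norm_cos_sub_le 0 a; have := norm_sin_sub_le 0 a.
  by rewrite -!ler_sqr_norm cos0 sin0 !subr0; lra.
have le4 : (cos a - 1) ^+ 2 + sin a ^+ 2 <= 4.
  by have := cos2Dsin2 a; have := cos_geN1 a; nra.
by have := sqr_ge0 K; nra.
Qed.

(** From 2|aa'| <= a^2 + a'^2. A sum of bounds, unlike their product, keeps the later domination
    linear in the spectral weight. *)
Lemma norm_dot2_le (R : realDomainType) (a b a' b' A B : R) :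
  a ^+ 2 + b ^+ 2 <= A -> a' ^+ 2 + b' ^+ 2 <= B -> `|a * a' + b * b'| <= A + B.
Proof.
move=> abA abB; rewrite ler_norml.
have := sqr_ge0 (a + a'); have := sqr_ge0 (a - a').
have := sqr_ge0 (b + b'); have := sqr_ge0 (b - b').
have := sqr_ge0 a; have := sqr_ge0 b; have := sqr_ge0 a'; have := sqr_ge0 b'.
by move=> *; apply/andP; split; nra.
Qed.

(** * Measurability of the integrands *)

Section measurability.
Context {R : realType} {N : nat}.

Lemma measurable_dotrV (s : 'rV[R]_N) : measurable_fun setT (dotrV s).
Proof.
apply: measurable_sum => i; apply: measurable_funM => //.
exact: measurable_coord.
Qed.

Lemma measurable_cos_dotrV (s : 'rV[R]_N) :
  measurable_fun setT (fun x => cos (dotrV s x)).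
Proof.
apply: (measurableT_comp _ (measurable_dotrV s)).
by apply: continuous_measurable_fun; exact: continuous_cos.
Qed.

Lemma measurable_sin_dotrV (s : 'rV[R]_N) :
  measurable_fun setT (fun x => sin (dotrV s x)).
Proof.
apply: (measurableT_comp _ (measurable_dotrV s)).
by apply: continuous_measurable_fun; exact: continuous_sin.
Qed.

Lemma measurable_enorm : measurable_fun setT (@enorm R N).
Proof.
apply: measurableT_comp.
  by apply: continuous_measurable_fun; exact: sqrt_continuous.
by apply: measurable_sum => i; apply: measurable_funX; exact: measurable_coord.
Qed.

Lemma measurable_coord_sqrM (j : 'I_N) (f : 'rV[R]_N -> R) :
  measurable_fun setT f ->
  measurable_fun setT (fun x : 'rV[R]_N => (x 0 j ^+ 2 * f x)%:E).
Proof.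
move=> mf; apply/measurable_EFinP; apply: measurable_funM => //.
by apply: measurable_funX; exact: measurable_coord.
Qed.

Lemma measurable_weightM (f : 'rV[R]_N -> R) : measurable_fun setT f ->
  measurable_fun setT (fun x => (enorm x ^+ 2 / (1 + enorm x ^+ 2) * f x)%:E).
Proof.
move=> mf; apply/measurable_EFinP/measurable_funM => //.
apply: (measurableT_comp _ measurable_enorm
  (f := fun y : R => y ^+ 2 / (1 + y ^+ 2))).
apply: continuous_measurable_fun => y.
have sqr_cvg : x ^+ 2 @[x --> y] --> y ^+ 2 by exact: exprn_continuous.
apply: cvgM => //; apply: cvgV; first by rewrite gt_eqF// ltr_pwDl ?sqr_ge0.
by apply: cvgD => //; exact: cvg_cst.
Qed.

End measurability.

Section spectral_isometry.
Context {R : realType} {d : measure_display} {T : measurableType d}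
  {P : probability T R} {N : nat} (X : 'rV[R]_N -> {RV P >-> R})
  (f : 'rV[R]_N -> R) (hgauss : gaussian_field X) (hf : spectral_density X f).
Local Notation mu := (lebesgue_rV R N).

Let f_ge0 x : 0 <= f x. Proof. by case: hf. Qed.
Let mf : measurable_fun setT f. Proof. by case: hf. Qed.

Lemma gaussian_field_Lfun2 t : (X t : T -> R) \in Lfun P 2%:E.
Proof.
apply: Lfun2_of_sqr_lty; first exact: measurable_funPT.
apply: gaussian_rv_sqr_lty.
rewrite (_ : (X t : T -> R) = fun w => \sum_(k < 1) 1 * X t w).
  exact: (hgauss (fun=> t) (fun=> 1)).
by apply/funext => w; rewrite big_ord1 mul1r.
Qed.

Lemma integrable_spectral_weight :
  mu.-integrable setT (fun x => (enorm x ^+ 2 / (1 + enorm x ^+ 2) * f x)%:E).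
Proof.
have w_ge0 x : 0 <= enorm x ^+ 2 / (1 + enorm x ^+ 2) * f x.
  by rewrite mulr_ge0 ?divr_ge0 ?sqr_ge0 ?addr_ge0 ?sqr_ge0.
apply/integrableP; split; last first.
  by case: hf => _ _ _ + _; under eq_integral do rewrite -[X in X%:E]ger0_norm//.
exact: measurable_weightM.
Qed.

(* The real part of (e^{i<s,x>} - 1) (e^{-i<t,x>} - 1) f(x). *)
Definition spectral_kernel (s t x : 'rV[R]_N) : R :=
  ((cos (dotrV s x) - 1) * (cos (dotrV t x) - 1) +
   sin (dotrV s x) * sin (dotrV t x)) * f x.

Lemma measurable_spectral_kernel s t : measurable_fun setT (spectral_kernel s t).
Proof.
have mc (u : 'rV[R]_N) : measurable_fun setT (fun x => cos (dotrV u x) - 1).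
  by apply: measurable_funB => //; exact: measurable_cos_dotrV.
apply: measurable_funM => //; apply: measurable_funD; apply: measurable_funM => //.
- exact: measurable_sin_dotrV.
- exact: measurable_sin_dotrV.
Qed.

(** |e^{i<u,x>} - 1|^2 is at most C(u) times the weight, so the kernel is dominated by C(s) + C(t)
    times the integrable weight. *)
Lemma integrable_spectral_kernel s t :
  mu.-integrable setT (EFin \o spectral_kernel s t).
Proof.
pose C (u : 'rV[R]_N) := 4 + 2 * (\sum_(i < N) `|u 0 i|) ^+ 2.
have iw := integrableZl measurableT (C s + C t) integrable_spectral_weight.
apply: le_integrable iw => //.
  by apply/measurable_EFinP; exact: measurable_spectral_kernel.
move=> x _; rewrite /= lee_fin /spectral_kernel normrM (ger0_norm (f_ge0 x)).
apply: le_trans (ler_norm _); rewrite [leRHS]mulrA ler_wpM2r// [leRHS]mulrDl.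
by apply: norm_dot2_le; exact: sqr_expi_sub1_le.
Qed.

(** Real parts are compared; the conjugation in the second factor gives the product of sines its
    plus sign. *)
Lemma covariance_functionE s t :
  covariance_function X s t = \int[mu]_x spectral_kernel s t x.
Proof.
case: hf => _ _ _ _ /(_ s t) /(congr1 (@complex.Re _)) /= ->.
apply: eq_Rintegral => x _; rewrite /spectral_kernel /= cosN sinN.
by ring.
Qed.

(** Both sides expand to the same quadratic form, with the covariances as its matrix. On the right
    stands |sum_k a_k (e^{i<t_k,x>} - 1)|^2 f(x), split into real and imaginary parts. *)
Lemma spectral_isometry (s : seq (R * 'rV[R]_N)) :
  (\int[P]_w ((\sum_(p <- s) p.1 * X p.2 w) ^+ 2)%:E =
   \int[mu]_x (((\sum_(p <- s) p.1 * (cos (dotrV p.2 x) - 1)) ^+ 2 +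
                (\sum_(p <- s) p.1 * sin (dotrV p.2 x)) ^+ 2) * f x)%:E)%E.
Proof.
under eq_integral do rewrite (sqr_sum_mul s (fun t => X t _)).
rewrite (integral_sum_mul _ (G := fun t u w => X t w * X u w)); last first.
  by move=> k l; apply/Lfun1_integrable/Lfun2_mul_Lfun1; exact: gaussian_field_Lfun2.
transitivity (\int[mu]_x (\sum_(p <- s) \sum_(q <- s)
    p.1 * q.1 * spectral_kernel p.2 q.2 x)%:E)%E; last first.
  apply: eq_integral => x _; congr EFin.
  rewrite (sqr_sum_mul s (fun t => cos (dotrV t x) - 1)).
  rewrite (sqr_sum_mul s (fun t => sin (dotrV t x))).
  rewrite -big_split mulr_suml; apply: eq_bigr => p _.
  rewrite -big_split mulr_suml; apply: eq_bigr => q _ /=.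
  by rewrite /spectral_kernel; ring.
rewrite integral_sum_mul; last exact: integrable_spectral_kernel.
congr EFin; apply: eq_bigr => p _; apply: eq_bigr => q _; congr (_ * _).
by rewrite -covariance_functionE /covariance_function unlock.
Qed.

End spectral_isometry.

(** * Mean square differentiability and the second spectral moment *)

(** [cos_quotient] and [sin_quotient] are the real and imaginary parts of the difference quotient of
    e^{i<t,x>} along e_j, for a = <t,x> and c = x_j. *)
Definition cos_quotient (R : realType) (a c h : R) : R := (cos (a + h * c) - cos a) / h.
Definition sin_quotient (R : realType) (a c h : R) : R := (sin (a + h * c) - sin a) / h.

(** At h = 0 the quotient is 0 by convention, so the bound holds for every [h]. *)
Lemma norm_divr_le (R : numFieldType) (y c h : R) : `|y| <= `|h * c| -> `|y / h| <= `|c|.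
Proof.
have [->|h0 ych] := eqVneq h 0; first by rewrite invr0 mulr0 normr0.
by rewrite normrM normfV ler_pdivrMr ?normr_gt0// [X in _ <= X]mulrC -normrM.
Qed.

Lemma norm_cos_quotient_le (R : realType) (a c h : R) : `|cos_quotient a c h| <= `|c|.
Proof.
apply: norm_divr_le; apply: (le_trans (norm_cos_sub_le _ _)).
by rewrite addrAC subrr add0r.
Qed.

Lemma norm_sin_quotient_le (R : realType) (a c h : R) : `|sin_quotient a c h| <= `|c|.
Proof.
apply: norm_divr_le; apply: (le_trans (norm_sin_sub_le _ _)).
by rewrite addrAC subrr add0r.
Qed.

Lemma cvg_quotient_comp_line (R : realType) (g : R -> R) (a c dg : R) :
  is_derive a 1 g dg -> (g (a + h * c) - g a) / h @[h --> 0^'] --> c * dg.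
Proof.
move=> gdg.
have line : is_derive (0 : R) 1 (fun h : R => a + h * c) c.
  by apply: is_derive_eq; rewrite scaler0 !add0r mul1r /GRing.scale/= mulr1.
have gdg' : is_derive (a + 0 * c) 1 g dg by rewrite mul0r addr0.
have [Dcvg Dval] := @is_derive1_comp _ g (fun h => a + h * c) 0 dg c gdg' line.
pose G := g \o (fun h => a + h * c).
rewrite mulrC (_ : (fun h => _ / h) =
    (fun h => h^-1 *: ((G \o shift 0) (h *: 1) - G 0))); last first.
  apply/funext => h; rewrite /G /= mul0r !addr0 /GRing.scale/= mulr1.
  by rewrite [RHS]mulrC.
by rewrite -Dval; exact: Dcvg.
Qed.

Lemma cvg_cos_quotient (R : realType) (a c : R) :
  cos_quotient a c h @[h --> 0^'] --> c * - sin a.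
Proof. exact: cvg_quotient_comp_line (is_derive_cos a). Qed.

Lemma cvg_sin_quotient (R : realType) (a c : R) :
  sin_quotient a c h @[h --> 0^'] --> c * cos a.
Proof. exact: cvg_quotient_comp_line (is_derive_sin a). Qed.

(** Stands in for the triangle inequality of L^2, and allows infinite integrals. *)
Lemma integral_sqrD_le d (T : measurableType d) (R : realType)
    (mu : {measure set T -> \bar R}) (u v : T -> R) :
  measurable_fun setT u -> measurable_fun setT v ->
  (\int[mu]_x ((u x + v x) ^+ 2)%:E <=
   2%:E * \int[mu]_x (u x ^+ 2)%:E + 2%:E * \int[mu]_x (v x ^+ 2)%:E)%E.
Proof.
move=> mu_ mv.
have msqr (w : T -> R) : measurable_fun setT w ->
    measurable_fun setT (fun x => (w x ^+ 2)%:E).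
  by move=> mw; apply/measurable_EFinP; exact: measurable_funX.
have sqr_ge0 (w : R) : (0 <= (w ^+ 2)%:E)%E by rewrite lee_fin sqr_ge0.
rewrite -!ge0_integralZl//; [|exact: msqr..].
rewrite -ge0_integralD//; last 4 first.
- by move=> x _; rewrite mule_ge0 ?sqr_ge0 ?lee_fin.
- by apply: measurable_funeM; exact: msqr.
- by move=> x _; rewrite mule_ge0 ?sqr_ge0 ?lee_fin.
- by apply: measurable_funeM; exact: msqr.
apply: ge0_le_integral => //.
- by apply: msqr; exact: measurable_funD.
- by apply: emeasurable_funD; apply: measurable_funeM; exact: msqr.
move=> x _; rewrite -!EFinM -EFinD lee_fin.
by have := Num.Theory.sqr_ge0 (u x - v x); nra.
Qed.

Lemma cvg_seq_dnbhs (T : topologicalType) (u : nat -> T) (p : T) :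
  (forall n, u n != p) -> u @ \oo --> p -> u @ \oo --> p^'.
Proof.
move=> up ucvg A Ap.
have : \forall n \near \oo, u n != p -> A (u n) by exact: ucvg Ap.
by apply: filterS => n /(_ (up n)).
Qed.

Section mean_square_derivative.
Context {R : realType} {d : measure_display} {T : measurableType d}
  {P : probability T R} {N : nat} (X : 'rV[R]_N -> {RV P >-> R})
  (f : 'rV[R]_N -> R) (hgauss : gaussian_field X) (hf : spectral_density X f)
  (j : 'I_N) (t : 'rV[R]_N).
Local Notation mu := (lebesgue_rV R N).

Let f_ge0 x : 0 <= f x. Proof. by case: hf. Qed.
Let mf : measurable_fun setT f. Proof. by case: hf. Qed.

(** [D] is the quotient of X; [C] and [S] are the two parts of its spectral counterpart, and [C0]
    and [S0] those of the limit i x_j e^{i<t,x>}. *)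
Let D (h : R) (w : T) : R := (X (t + h *: delta_mx 0 j) w - X t w) / h.
Let C h x := cos_quotient (dotrV t x) (x 0 j) h.
Let S h x := sin_quotient (dotrV t x) (x 0 j) h.
Let C0 (x : 'rV[R]_N) := x 0 j * - sin (dotrV t x).
Let S0 (x : 'rV[R]_N) := x 0 j * cos (dotrV t x).

Lemma dotrVDdelta h x : dotrV (t + h *: delta_mx 0 j) x = dotrV t x + h * x 0 j.
Proof.
rewrite /dotrV; under eq_bigr do rewrite !mxE eqxx mulrDl.
rewrite big_split /=; congr (_ + _); rewrite (bigD1 j)//= eqxx mulr1 big1 ?addr0//.
by move=> i /negbTE ->; rewrite mulr0 mul0r.
Qed.

Let mcoord : measurable_fun setT (fun x : 'rV[R]_N => x 0 j).
Proof. exact: measurable_coord. Qed.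

Let mD h : measurable_fun setT (D h).
Proof. by apply: measurable_funM => //; exact: measurable_funB. Qed.

Let mC h : measurable_fun setT (C h).
Proof.
apply: measurable_funM => //; apply: measurable_funB.
  have := measurable_cos_dotrV (t + h *: delta_mx 0 j).
  by under eq_fun do rewrite dotrVDdelta.
exact: measurable_cos_dotrV.
Qed.

Let mS h : measurable_fun setT (S h).
Proof.
apply: measurable_funM => //; apply: measurable_funB.
  have := measurable_sin_dotrV (t + h *: delta_mx 0 j).
  by under eq_fun do rewrite dotrVDdelta.
exact: measurable_sin_dotrV.
Qed.

Let mC0 : measurable_fun setT C0.
Proof.
apply: measurable_funM => //; apply: measurableT_comp => //.
exact: measurable_sin_dotrV.
Qed.

Let mS0 : measurable_fun setT S0.
Proof. by apply: measurable_funM => //; exact: measurable_cos_dotrV. Qed.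

Let mqf (u v : 'rV[R]_N -> R) : measurable_fun setT u -> measurable_fun setT v ->
  measurable_fun setT (fun x => ((u x ^+ 2 + v x ^+ 2) * f x)%:E).
Proof.
move=> mu_ mv; apply/measurable_EFinP/measurable_funM => //.
by apply: measurable_funD; exact: measurable_funX.
Qed.

Let qf_ge0 (u v : R) x : (0 <= ((u ^+ 2 + v ^+ 2) * f x)%:E)%E.
Proof. by rewrite lee_fin mulr_ge0 ?addr_ge0 ?sqr_ge0. Qed.

(** [D h - D k] combines three values of X with coefficients of sum 0, so the constants -1 in the
    isometry cancel. *)
Lemma integral_quotient_sub_sqr h k :
  (\int[P]_w ((D h w - D k w) ^+ 2)%:E =
   \int[mu]_x (((C h x - C k x) ^+ 2 + (S h x - S k x) ^+ 2) * f x)%:E)%E.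
Proof.
have := spectral_isometry hgauss hf [:: (h^-1, t + h *: delta_mx 0 j);
  (- k^-1, t + k *: delta_mx 0 j); (k^-1 - h^-1, t)].
under eq_integral do rewrite !big_cons big_nil /= addr0.
under [X in _ = X]eq_integral do
  rewrite !big_cons !big_nil /= !addr0 !dotrVDdelta.
move=> iso; transitivity
  (\int[P]_w ((h^-1 * X (t + h *: delta_mx 0 j) w +
    (- k^-1 * X (t + k *: delta_mx 0 j) w + (k^-1 - h^-1) * X t w)) ^+ 2)%:E)%E.
  by apply: eq_integral => w _; rewrite /D; congr ((_ ^+ 2)%:E); ring.
rewrite iso; apply: eq_integral => x _; congr ((_ * _)%:E).
by rewrite /C /S /cos_quotient /sin_quotient; congr (_ ^+ 2 + _ ^+ 2); ring.
Qed.

(* Division by zero makes the difference quotients at [h = 0] vanish. *)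
Lemma integral_quotient_sqr h :
  (\int[P]_w ((D h w) ^+ 2)%:E = \int[mu]_x ((C h x ^+ 2 + S h x ^+ 2) * f x)%:E)%E.
Proof.
have := integral_quotient_sub_sqr h 0.
rewrite /D /C /S /cos_quotient /sin_quotient invr0.
under eq_integral do rewrite mulr0 subr0.
by under [X in _ = X]eq_integral do rewrite !mulr0 !subr0.
Qed.

(** Twice the squared L^2(f) distance from the spectral quotient to its limit; the 2 comes from (a -
    b)^2 <= 2 a^2 + 2 b^2 when two quotients are compared through that limit. *)
Let delta (h : R) : \bar R :=
  (2%:E * \int[mu]_x (((C h x - C0 x) ^+ 2 + (S h x - S0 x) ^+ 2) * f x)%:E)%E.

Let delta_ge0 h : (0 <= delta h)%E.
Proof. by rewrite mule_ge0 ?lee_fin// integral_ge0. Qed.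

Let quotient_cauchy h k : (\int[P]_w ((D h w - D k w) ^+ 2)%:E <= delta h + delta k)%E.
Proof.
have md l : measurable_fun setT
    (fun x => (((C l x - C0 x) ^+ 2 + (S l x - S0 x) ^+ 2) * f x)%:E).
  by apply: mqf; exact: measurable_funB.
rewrite integral_quotient_sub_sqr /delta -!ge0_integralZl// -ge0_integralD//.
- apply: ge0_le_integral => //.
  + by apply: mqf; exact: measurable_funB.
  + by apply: emeasurable_funD; apply: measurable_funeM.
  move=> x _; rewrite -!EFinM -EFinD lee_fin !mulrA -mulrDl ler_wpM2r//.
  have := sqr_ge0 ((C h x - C0 x) + (C k x - C0 x)).
  have := sqr_ge0 ((S h x - S0 x) + (S k x - S0 x)).
  by nra.
- by move=> x _; rewrite mule_ge0 ?qf_ge0 ?lee_fin.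
- by apply: measurable_funeM.
- by move=> x _; rewrite mule_ge0 ?qf_ge0 ?lee_fin.
- by apply: measurable_funeM.
Qed.

Let norm_limit_quotient_le x : `|C0 x| <= `|x 0 j| /\ `|S0 x| <= `|x 0 j|.
Proof.
by rewrite /C0 /S0 !normrM normrN; split; rewrite ler_piMr ?sin_max ?cos_max.
Qed.

(** Quotients and limits are bounded by |x_j|, so each of the two squares is at most 4 x_j^2; the
    majorant does not depend on [h]. *)
Let error_le h (x : 'rV[R]_N) :
  ((C h x - C0 x) ^+ 2 + (S h x - S0 x) ^+ 2) * f x <= 8 * (x 0 j ^+ 2 * f x).
Proof.
rewrite mulrA ler_wpM2r//.
have sub_sqr_le (a b c : R) :
    `|a| <= `|c| -> `|b| <= `|c| -> (a - b) ^+ 2 <= 4 * c ^+ 2.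
  rewrite -!ler_sqr_norm => ac bc.
  by have := sqr_ge0 (a + b); nra.
have [C0x S0x] := norm_limit_quotient_le x.
have := sub_sqr_le _ _ _ (norm_cos_quotient_le (dotrV t x) (x 0 j) h) C0x.
have := sub_sqr_le _ _ _ (norm_sin_quotient_le (dotrV t x) (x 0 j) h) S0x.
by rewrite -/(C h x) -/(S h x); lra.
Qed.

Let mx2f := measurable_coord_sqrM j mf.

Let x2f_ge0 (x : 'rV[R]_N) : (0 <= (x 0 j ^+ 2 * f x)%:E)%E.
Proof. by rewrite lee_fin mulr_ge0 ?sqr_ge0. Qed.

Let delta_cvg0 :
  (\int[mu]_(x in [set: 'rV[R]_N]) (x 0 j ^+ 2 * f x)%:E < +oo)%E ->
  delta h @[h --> 0^'] --> 0%E.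
Proof.
move=> x2foo.
have ix2f : mu.-integrable setT (fun x : 'rV[R]_N => (x 0 j ^+ 2 * f x)%:E).
  by apply/integrableP; split=> //; under eq_integral do rewrite gee0_abs//.
have i8 := integrableZl measurableT 8 ix2f.
pose e h x := (((C h x - C0 x) ^+ 2 + (S h x - S0 x) ^+ 2) * f x)%:E.
have me h : measurable_fun setT (e h) by apply: mqf; exact: measurable_funB.
rewrite -(mule0 2%:E); apply: cvgeZl => //.
have efin h : (\int[mu]_x e h x)%E \is a fin_num.
  apply: integrable_fin_num => //; apply: le_integrable i8 => // x _.
  rewrite gee0_abs; last exact: qf_ge0.
  rewrite gee0_abs; last by rewrite mule_ge0 ?x2f_ge0 ?lee_fin.
  exact: error_le.
apply: cvg_EFin; first exact: nearW.
(* Dominated convergence concerns sequences, so the limit at 0 is tested along sequences of nonzero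
   [u n]. *)
apply/cvgr_dnbhsP => u [u0 ucvg].
have {}ucvg : u @ \oo --> (0 : R)^' by exact: cvg_seq_dnbhs.
have [|||_ _ /=] := @dominated_convergence _ _ _ mu _ measurableT
  (fun n => e (u n)) (cst 0%E) _ (fun n => me (u n)) _ _ i8.
- exact: measurable_cst.
- apply: aeW => x _; apply: cvg_EFin; first exact: nearW.
  rewrite -[X in _ --> X](mul0r (f x)); apply: cvgM; last exact: cvg_cst.
  have -> : 0 = (C0 x - C0 x) ^+ 2 + (S0 x - S0 x) ^+ 2.
    by rewrite !subrr expr0n addr0.
  have sqr_cvg (q : R -> R) l : q h @[h --> 0^'] --> l ->
      (q (u n) - l) ^+ 2 @[n --> \oo] --> (l - l) ^+ 2.
    move=> ql; have {ql} : (q \o u) n @[n --> \oo] --> l by exact: cvg_comp ql.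
    by move=> ql; rewrite expr2; apply: cvgM; apply: cvgB => //; exact: cvg_cst.
  by apply: cvgD; apply: sqr_cvg; [exact: cvg_cos_quotient|exact: cvg_sin_quotient].
- apply: aeW => x n _; rewrite gee0_abs; [exact: error_le|exact: qf_ge0].
rewrite integral_cst// mul0e => /fine_cvgP[_].
by [].
Qed.


(** With a finite moment [delta] tends to 0, so the quotients are Cauchy and completeness provides
    the derivative. *)
Lemma ms_partial_of_second_moment :
  (\int[mu]_(x in [set: 'rV[R]_N]) (x 0 j ^+ 2 * f x)%:E < +oo)%E ->
  ms_partial_exists X j t.
Proof.
move=> x2foo; have delta0 := delta_cvg0 x2foo.
have [Y DY] := L2_complete_dnbhs mD delta_ge0 delta0
  (fun h k _ _ => quotient_cauchy h k).
have mY : measurable_fun setT Y by exact: measurable_funPT.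
have delta1 : (delta 1 < +oo)%E.
  apply: lte_mul_pinfty => //.
  apply: (@le_lt_trans _ _ (\int[mu]_x (8%:E * (x 0 j ^+ 2 * f x)%:E))%E).
    apply: ge0_le_integral => //.
    - by apply: mqf; exact: measurable_funB.
    - exact: measurable_funeM.
    by move=> x _; rewrite -EFinM lee_fin; exact: error_le.
  by rewrite ge0_integralZl// lte_mul_pinfty.
have D1 : (\int[P]_w (D 1 w ^+ 2)%:E < +oo)%E.
  rewrite integral_quotient_sqr.
  apply: (@le_lt_trans _ _ (\int[mu]_x (2%:E * (x 0 j ^+ 2 * f x)%:E))%E).
    apply: ge0_le_integral => //.
    - exact: mqf.
    - by apply: measurable_funeM.
    move=> x _; rewrite -EFinM lee_fin mulrA ler_wpM2r//.
    rewrite mulr_natl mulr2n lerD// ler_sqr_norm.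
      exact: norm_cos_quotient_le.
    exact: norm_sin_quotient_le.
  by rewrite ge0_integralZl// lte_mul_pinfty.
exists Y; split.
  apply: Lfun2_of_sqr_lty => //.
  (* [Y] is square integrable as (Y - D 1) + D 1; h = 1 is just a convenient nonzero increment. *)
  have := integral_sqrD_le P (measurable_funB mY (mD 1)) (mD 1).
  under eq_integral do rewrite subrK.
  move=> /le_lt_trans; apply; rewrite lte_add_pinfty ?lte_mul_pinfty//.
  under eq_integral do rewrite -sqrrN opprB.
  exact: le_lt_trans (DY 1 (oner_neq0 R)) delta1.
apply/Lnorm2_cvg0/ge0_cvge0P => [h|e e0].
  by apply: integral_ge0 => w _; rewrite lee_fin sqr_ge0.
have h0 : \forall h \near (0 : R)^', h != 0 by exact: nbhs_dnbhs_neq.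
apply: filterS2 h0 ((ge0_cvge0P delta_ge0).1 delta0 e e0) => h h0.
by apply: le_lt_trans; exact: DY.
Qed.

(** An L^2 limit keeps the second moments of the quotients bounded near 0; the isometry carries the
    bound to the spectral side, where the quotients converge pointwise and Fatou applies. *)
Lemma second_moment_of_ms_partial : ms_partial_exists X j t ->
  (\int[mu]_(x in [set: 'rV[R]_N]) (x 0 j ^+ 2 * f x)%:E < +oo)%E.
Proof.
move=> [Y [Y2 /Lnorm2_cvg0 DY]].
have mY : measurable_fun setT Y by exact: measurable_funPT.
have {}Y2 : (\int[P]_w (Y w ^+ 2)%:E < +oo)%E.
  have /integrableP[_] := Lfun2_integrable_sqr Y2.
  by under eq_integral do rewrite gee0_abs ?lee_fin ?sqr_ge0//.
(* [M] bounds E[D^2] through D = (D - Y) + Y as soon as E[(D - Y)^2] < 1. *)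
pose M := (2%:E * 1%:E + 2%:E * \int[P]_w (Y w ^+ 2)%:E)%E.
have Moo : (M < +oo)%E by rewrite lte_add_pinfty// lte_mul_pinfty// ltry.
apply: le_lt_trans Moo.
have int_ge0 h : (0 <= \int[P]_w ((D h w - Y w) ^+ 2)%:E)%E.
  by apply: integral_ge0 => w _; rewrite lee_fin sqr_ge0.
have near1 := (ge0_cvge0P int_ge0).1 DY 1 ltr01.
have ex_h n : exists h, [/\ h != 0, `|h| < n.+1%:R^-1 &
    (\int[P]_w ((D h w - Y w) ^+ 2)%:E < 1)%E].
  have /filter_ex[h []] : \forall h \near (0 : R)^',
      [/\ h != 0, `|h| < n.+1%:R^-1 & (\int[P]_w ((D h w - Y w) ^+ 2)%:E < 1)%E].
    near=> h; split; first by near: h; exact: nbhs_dnbhs_neq.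
    - by near: h; apply: dnbhs0_lt; rewrite invr_gt0.
    - by near: h; exact: near1.
  by exists h.
have [h hP] := choice ex_h.
have hcvg : h @ \oo --> (0 : R)^'.
  apply: cvg_seq_dnbhs => [n|]; first by case: (hP n).
  apply/cvgr0Pnorm_lt => e e0.
  have := near_infty_natSinv_lt (PosNum e0); apply: filterS => n.
  by apply: lt_trans; case: (hP n).
apply: (@fatou_ae_cvg _ _ _ mu
  (fun n x => ((C (h n) x ^+ 2 + S (h n) x ^+ 2) * f x)%:E) _ (fun=> M)) => //.
- by move=> n; exact: mqf.
- apply: aeW => x; apply: cvg_EFin; first exact: nearW.
  apply: cvgM; last exact: cvg_cst.
  have -> : x 0 j ^+ 2 = C0 x ^+ 2 + S0 x ^+ 2.
    by rewrite /C0 /S0 !exprMn sqrrN -mulrDr addrC cos2Dsin2 mulr1.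
  have sqr_cvg (q : R -> R) (l : R) : q h @[h --> 0^'] --> l ->
      (q (h n)) ^+ 2 @[n --> \oo] --> l ^+ 2.
    move=> ql; have {}ql : (q \o h) n @[n --> \oo] --> l by exact: cvg_comp ql.
    by rewrite expr2; exact: cvgM.
  by apply: cvgD; apply: sqr_cvg; [exact: cvg_cos_quotient|exact: cvg_sin_quotient].
- move=> n; rewrite -integral_quotient_sqr.
  have := integral_sqrD_le P (measurable_funB (mD (h n)) mY) mY.
  under eq_integral do rewrite subrK.
  move=> /le_trans; apply; rewrite leeD2r// lee_wpmul2l//.
  by case: (hP n) => _ _ /ltW.
exact: cvg_cst.
Unshelve. all: by end_near. Qed.

End mean_square_derivative.

(** * The second moment of an anisotropic power law *)

Section boxes.
Context {R : realType} {n : nat}.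

Lemma measurable_box (A : 'I_n -> set R) :
  (forall i, measurable (A i : set (measurableTypeR R))) ->
  measurable [set x : 'rV[R]_n | forall i, A i (x 0 i)].
Proof.
move=> mA; rewrite [X in measurable X](_ : _ = \bigcap_(i in [set: 'I_n])
    ((fun x : 'rV[R]_n => x 0 i : measurableTypeR R) @^-1` A i)).
  apply: fin_bigcap_measurable => // i _.
  by rewrite -[X in measurable X]setTI; exact: measurable_coord.
by apply/seteqP; split=> [x h i _|x h i]; exact: h.
Qed.

(** The flags [l] and [r] make the ends closed or open: closed boxes serve the upper bound,
    left-open cells the lower one. *)
Lemma lebesgue_rV_itv_box (l r : bool) (a b : 'I_n -> R) : (forall i, a i <= b i) ->
  lebesgue_rV R n
    [set x | forall i, [set` Interval (BSide l (a i)) (BSide r (b i))] (x 0 i)] =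
  (\prod_(i < n) (b i - a i))%:E.
Proof.
move=> ab; rewrite (@lebesgue_rV_box _ _
  (fun i => [set` Interval (BSide l (a i)) (BSide r (b i))])) => [|i]; last first.
  exact: measurable_itv.
rewrite -prodEFin; apply: eq_bigr => i _; rewrite lebesgue_measure_itv /= lte_fin.
by case: ltgtP (ab i) => // -> _; rewrite subrr.
Qed.

End boxes.

Lemma nneseries_geometric_lty (R : realType) (C z : R) : 0 <= C -> 0 < z < 1 ->
  (\sum_(0 <= k <oo) (C * z ^+ k)%:E < +oo)%E.
Proof.
move=> C0 /andP[z0 z1]; apply: (@le_lt_trans _ _ (C / (1 - z))%:E); last exact: ltry.
apply: lime_le.
  by apply: is_cvg_nneseries => k _ _; rewrite lee_fin mulr_ge0 ?exprn_ge0// ltW.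
apply: nearW => m; rewrite sumEFin lee_fin.
by apply: geometric_le_lim => //; rewrite gtr0_norm.
Qed.

Lemma expR_prod (R : realType) n (u : 'I_n -> R) :
  \prod_(i < n) expR (u i) = expR (\sum_(i < n) u i).
Proof.
elim: n u => [|n IH] u; first by rewrite !big_ord0 expR0.
by rewrite !big_ord_recl expRD IH.
Qed.

Section anisotropic_integral.
Context {R : realType} {N : nat} (f : 'rV[R]_N -> R) (c1 c2 c3 gamma : R)
  (beta : 'I_N -> R) (j : 'I_N) (mf : measurable_fun setT f)
  (f_ge0 : forall x, 0 <= f x)
  (f_weight : (\int[lebesgue_rV R N]_x
     (enorm x ^+ 2 / (1 + enorm x ^+ 2) * f x)%:E < +oo)%E)
  (c1_gt0 : 0 < c1) (c2_gt0 : 0 < c2) (c3_gt0 : 0 < c3) (gamma_gt0 : 0 < gamma)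
  (beta_gt0 : forall i, 0 < beta i)
  (f_bound : forall x : 'rV[R]_N, c3 <= enorm x ->
     c1 / aniso_power beta gamma x <= f x <= c2 / aniso_power beta gamma x).
Local Notation mu := (lebesgue_rV R N).

(** [aniso_power] is [rho] to the power [gamma]. The radii are such that rho <= e^k confines |x_i|
    to [radius k i], and [r] is the logarithm of the ratio of the geometric series. *)
Let rho (x : 'rV[R]_N) : R := \sum_(i < N) `|x 0 i| `^ beta i.
Let radius (k : nat) (i : 'I_N) : R := expR (k%:R / beta i).
Let Q : R := \sum_(i < N) (beta i)^-1.
Let r : R := 2 / beta j + Q - gamma.

Let powR_radius k i : radius k i `^ beta i = expR k%:R.
Proof. by rewrite /radius -expRM divfK// gt_eqF. Qed.

Let rho_ge i (x : 'rV[R]_N) : `|x 0 i| `^ beta i <= rho x.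
Proof. by rewrite /rho (bigD1 i)//= lerDl sumr_ge0// => *; exact: powR_ge0. Qed.

Let coord_le_radius k (x : 'rV[R]_N) i : rho x <= expR k%:R -> `|x 0 i| <= radius k i.
Proof.
move=> xk; rewrite leNgt; apply/negP => kx.
have := gt0_ltr_powR (beta_gt0 i) _ _ kx.
rewrite powR_radius !nnegrE expR_ge0 normr_ge0 => /(_ isT isT).
by rewrite ltNge (le_trans (rho_ge i x)).
Qed.

(** All |x_i| are at most 1, hence x_i^2 <= N. Used in contrapositive form: far points have rho >
    1. *)
Let enorm_le_of_rho_le1 x : rho x <= 1 -> enorm x <= N%:R.
Proof.
move=> rho1; have x1 : rho x <= expR 0%:R by rewrite expR0.
rewrite -[leRHS]ger0_norm// -sqrtr_sqr ler_wsqrtr//.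
apply: (@le_trans _ _ (\sum_(i < N) N%:R)); last first.
  by rewrite sumr_const card_ord -mulrnA -natrX mulnn.
apply: ler_sum => i _.
rewrite -real_normK ?num_real//.
have := coord_le_radius i (k := 0) x1; rewrite /radius mul0r expR0.
have : (1 <= N%:R :> R) by rewrite ler1n (leq_trans _ (ltn_ord i)).
by have := normr_ge0 (x 0 i); nra.
Qed.

(** * Covering by boxes and finiteness of the moment *)

Let box k := [set x : 'rV[R]_N |
  forall i, [set` Interval (BLeft (- radius k i)) (BRight (radius k i))] (x 0 i)].

(* bounds [x 0 j ^+ 2 * f x] on [box k `\` box k.-1] *)
Let height k := c2 * expR (k%:R * (2 / beta j) - (k%:R - 1) * gamma).

Let height_ge0 k : 0 <= height k.
Proof. by rewrite mulr_ge0 ?expR_ge0// ltW. Qed.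

Let coord_sqr_f_le (x : 'rV[R]_N) : c3 <= enorm x -> 1 < rho x ->
  exists k, box k x /\ x 0 j ^+ 2 * f x <= height k.
Proof.
move=> xc3 rho1.
have ex_k : exists k : nat, rho x <= expR k%:R.
  exists (Num.bound (rho x)); apply: le_trans (expR_ge1Dx _).
  by rewrite (le_trans (ltW (archi_boundP _)))// ?lerDr// ltW// (lt_trans ltr01).
(* The least [k] with rho <= e^k is positive because rho > 1; minimality gives rho >= e^{k-1}, which
   bounds f from above. *)
case: (ex_minnP ex_k) => -[|k].
  by rewrite expR0 leNgt rho1.
move=> xk kmin; exists k.+1; split.
  by move=> i /=; rewrite in_itv/= -ler_norml; exact: coord_le_radius.
have kx : expR k%:R <= rho x.
  by rewrite leNgt; apply/negP => /ltW/kmin; rewrite ltnn.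
have /andP[_ fx] := f_bound xc3.
apply: (@le_trans _ _ (radius k.+1 j ^+ 2 * (c2 / expR k%:R `^ gamma))).
  apply: ler_pM => //; first exact: sqr_ge0.
    rewrite ler_sqr_norm (le_trans (coord_le_radius _ xk))//.
    exact: ler_norm.
  apply: (le_trans fx); rewrite ler_pM2l// lef_pV2 ?posrE ?powR_gt0//.
  - by rewrite ge0_ler_powR// ?ltW// nnegrE ?expR_ge0// ltW// (lt_trans ltr01).
  - by rewrite (lt_trans ltr01).
rewrite -expRM /radius /height -expRM_natl mulrCA -expRN -expRD ler_pM2l// ler_expR.
by rewrite -[k.+1]addn1 natrD; lra.
Qed.

Let mbox k : measurable (box k).
Proof.
apply: (@measurable_box _ _
  (fun i => [set` Interval (BLeft (- radius k i)) (BRight (radius k i))])) => i.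
exact: measurable_itv.
Qed.

(** The exponent is 2k/beta_j - (k - 1) gamma + kQ = gamma + kr, and the sides 2 e^{k/beta_i} give
    the factor 2^N. *)
Let height_box k :
  ((height k)%:E * mu (box k) = (c2 * expR gamma * 2 ^+ N * expR r ^+ k)%:E)%E.
Proof.
rewrite /box lebesgue_rV_itv_box => [|i]; last first.
  by rewrite (@le_trans _ _ 0) ?oppr_le0 ?expR_ge0.
rewrite -EFinM; congr EFin.
under eq_bigr do rewrite opprK -mulr2n -mulr_natl.
rewrite big_split/= prodr_const card_ord /radius expR_prod -mulr_sumr -/Q.
rewrite -expRM_natl /height /r.
transitivity (c2 * 2 ^+ N * (expR gamma * expR (k%:R * (2 / beta j + Q - gamma)))).
  rewrite -expRD mulrACA -expRD; congr (_ * expR _); ring.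
by ring.
Qed.

Let mx2f := measurable_coord_sqrM j mf.

Let x2f_ge0 (x : 'rV[R]_N) : (0 <= (x 0 j ^+ 2 * f x)%:E)%E.
Proof. by rewrite lee_fin mulr_ge0 ?sqr_ge0. Qed.

(** Within norm [M], x_j^2 f is at most (1 + M^2) times the spectral weight times f; beyond it, the
    sum over k of [height k] on [box k] dominates, and its integral is a geometric series of ratio
    e^r < 1. *)
Lemma second_moment_lty : r < 0 ->
  (\int[mu]_(x in [set: 'rV[R]_N]) (x 0 j ^+ 2 * f x)%:E < +oo)%E.
Proof.
move=> r0; have mw := measurable_weightM mf.
pose w (x : 'rV[R]_N) := enorm x ^+ 2 / (1 + enorm x ^+ 2) * f x.
have w_ge0 x : 0 <= w x.
  by apply: mulr_ge0 => //; apply: divr_ge0; rewrite ?addr_ge0 ?sqr_ge0.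
(* Beyond norm [M] both the power bounds on f and rho > 1 hold. *)
pose M := c3 + N%:R; pose g k x := (height k * \1_(box k) x)%:E.
have g_ge0 k x : (0 <= g k x)%E by rewrite lee_fin mulr_ge0.
have mg k : measurable_fun setT (g k).
  by apply/measurable_EFinP; apply: measurable_funM => //; exact: measurable_indic.
have mS : measurable_fun setT (fun x => \sum_(0 <= k <oo) g k x)%E.
  by apply: (@ge0_emeasurable_sum _ _ _ _ g xpredT).
have S_ge0 x : (0 <= \sum_(0 <= k <oo) g k x)%E by apply: nneseries_ge0.
have M1_ge0 : 0 <= 1 + M ^+ 2 by rewrite addr_ge0 ?sqr_ge0.
apply: (@le_lt_trans _ _
    (\int[mu]_x ((1 + M ^+ 2)%:E * (w x)%:E + \sum_(0 <= k <oo) g k x))%E).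
  apply: ge0_le_integral => //.
    by apply: emeasurable_funD => //; exact: measurable_funeM.
  move=> x _; have [xM|xM] := leP (enorm x) M.
    apply: (@le_trans _ _ ((1 + M ^+ 2) * w x)%:E); last by rewrite EFinM leeDl.
    have q0 := sqr_ge0 (enorm x).
    rewrite lee_fin mulrA ler_wpM2r// mulrA ler_pdivlMr ?ltr_pwDl// [leRHS]mulrC.
    apply: ler_pM; rewrite ?sqr_ge0 ?addr_ge0//.
      by rewrite ler_sqr_norm (le_trans (norm_coord_le_enorm _ _))// ler_norm.
    by rewrite lerD2l ler_sqr ?nnegrE ?sqrtr_ge0// addr_ge0// ltW.
  have c3x : c3 <= enorm x by rewrite (le_trans _ (ltW xM))// lerDl.
  have rho1 : 1 < rho x.
    rewrite ltNge; apply/negP => /enorm_le_of_rho_le1; apply/negP.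
    by rewrite -ltNge (le_lt_trans _ xM)// lerDr ltW.
  have [k [xk x2k]] := coord_sqr_f_le c3x rho1.
  apply: (@le_trans _ _ (g k x)).
    by rewrite lee_fin /= indicE mem_set// mulr1.
  apply: (@le_trans _ _ (\sum_(0 <= i < k.+1) g i x)%E).
    by rewrite big_nat_recr//= leeDr// sume_ge0.
  apply: (le_trans (nneseries_lim_ge _ _)) => //.
  by rewrite leeDr// mule_ge0 ?lee_fin.
rewrite ge0_integralD//; last 2 first.
- by move=> x _; rewrite mule_ge0 ?lee_fin.
- by apply: measurable_funeM.
rewrite ge0_integralZl//; last by move=> x _; rewrite lee_fin.
rewrite integral_nneseries//.
apply: lte_add_pinfty; first by rewrite lte_mul_pinfty ?lee_fin.
have -> : (\sum_(0 <= k <oo) \int[mu]_x g k x =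
    \sum_(0 <= k <oo) (c2 * expR gamma * 2 ^+ N * expR r ^+ k)%:E)%E.
  apply: eq_eseriesr => k _; rewrite -height_box /g.
  under eq_integral do rewrite EFinM.
  rewrite ge0_integralZl ?lee_fin// ?integral_indic ?setIT//.
  by apply/measurable_EFinP; exact: measurable_indic.
apply: nneseries_geometric_lty.
  by rewrite !mulr_ge0 ?expR_ge0 ?exprn_ge0// ltW.
by rewrite expR_gt0 expR_lt1.
Qed.

(** * Disjoint cells and divergence of the moment *)

Let orthant k := [set x : 'rV[R]_N |
  forall i, [set` Interval (BRight (radius k i)) (BRight (radius k.+1 i))] (x 0 i)].

(* a lower bound of [x 0 j ^+ 2 * f x] on [orthant k] *)
Let low k := c1 / (N%:R * expR 1) `^ gamma * expR (k%:R * (2 / beta j - gamma)).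

Let ltr_radius k m i : (k < m)%N -> radius k i < radius m i.
Proof. by move=> km; rewrite ltr_expR ltr_pM2r ?invr_gt0// ltr_nat. Qed.

(** On the cell x_j > e^{k/beta_j}, while each of the N terms of rho is at most e^{k+1}; so f is at
    least c1 (N e^{k+1})^{-gamma}. *)
Let coord_sqr_f_ge k x : c3 <= radius k j -> orthant k x -> low k <= x 0 j ^+ 2 * f x.
Proof.
move=> c3k xk.
have xi i : radius k i < x 0 i <= radius k.+1 i.
  by have := xk i; rewrite /= in_itv.
have xpos i : 0 < x 0 i.
  by have /andP[+ _] := xi i; apply: le_lt_trans; exact: expR_ge0.
have N_gt0 : (0 < N%:R :> R) by rewrite ltr0n (leq_ltn_trans _ (ltn_ord j)).
have rho_gt0 : 0 < rho x.
  by apply: lt_le_trans (rho_ge j x); rewrite powR_gt0// normr_gt0 gt_eqF.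
have rho_le : rho x <= N%:R * expR 1 * expR k%:R.
  rewrite -mulrA -expRD.
  apply: (@le_trans _ _ (\sum_(i < N) expR (1 + k%:R))); last first.
    by rewrite sumr_const card_ord mulr_natl.
  apply: ler_sum => i _; rewrite addrC natr1 -(powR_radius _ i).
  have /andP[_ xle] := xi i.
  by rewrite gtr0_norm// ge0_ler_powR// ?nnegrE ?expR_ge0// ltW.
have c3x : c3 <= enorm x.
  apply: (le_trans c3k); apply: le_trans (norm_coord_le_enorm _ j).
  by rewrite gtr0_norm//; have /andP[/ltW] := xi j.
have /andP[fx _] := f_bound c3x.
apply: (@le_trans _ _ (radius k j ^+ 2 * (c1 / aniso_power beta gamma x))); last first.
  apply: ler_pM => //; first exact: sqr_ge0.
    by rewrite divr_ge0 ?powR_ge0// ltW.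
  rewrite ler_sqr ?nnegrE ?expR_ge0//; last exact: ltW.
  by have /andP[/ltW] := xi j.
apply: (@le_trans _ _ (radius k j ^+ 2 *
    (c1 / (N%:R * expR 1 * expR k%:R) `^ gamma))); last first.
  rewrite ler_wpM2l ?sqr_ge0// ler_pM2l// lef_pV2 ?posrE ?powR_gt0//.
    by rewrite ge0_ler_powR// ?nnegrE ?mulr_ge0 ?expR_ge0// ltW.
  by rewrite !mulr_gt0 ?expR_gt0.
rewrite [X in _ / X]powRM ?mulr_ge0 ?expR_ge0// -[expR k%:R `^ _]expRM.
rewrite /low /radius -expRM_natl invfM -[(expR (_ * gamma))^-1]expRN.
rewrite [X in _ <= X](_ : _ = c1 / (N%:R * expR 1) `^ gamma *
  (expR (2 * (k%:R / beta j)) * expR (- (k%:R * gamma)))); last by ring.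
by rewrite -expRD le_eqVlt; apply/orP; left; apply/eqP; congr (_ * expR _); ring.
Qed.

Let morthant k : measurable (orthant k).
Proof.
apply: (@measurable_box _ _
  (fun i => [set` Interval (BRight (radius k i)) (BRight (radius k.+1 i))])) => i.
exact: measurable_itv.
Qed.

(** The j-th coordinates of distinct cells already lie in disjoint left-open intervals. *)
Let trivIset_orthant : trivIset setT orthant.
Proof.
move=> k m _ _ [x [/(_ j) + /(_ j)]] /=; rewrite !in_itv /= => /andP[k1 k2] /andP[m1 m2].
have noLt a b : x 0 j <= radius a.+1 j -> radius b j < x 0 j -> (b <= a)%N.
  move=> xa xb; rewrite leqNgt; apply/negP => ab.
  have := lt_le_trans xb xa; rewrite ltNge; case/negP.
  have [->//|] := eqVneq a.+1 b; rewrite neq_ltn => /orP[/(ltr_radius j)/ltW//|].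
  by rewrite ltnNge ab.
by apply/eqP; rewrite eqn_leq (noLt _ _ m2 k1) (noLt _ _ k2 m1).
Qed.

(** The volume of the cell of index 0; that of index k has e^{kQ} times this volume. *)
Let vol1 := \prod_(i < N) (expR (beta i)^-1 - 1).

Let vol1_gt0 : 0 < vol1.
Proof. by apply: prodr_gt0 => i _; rewrite subr_gt0 expR_gt1 invr_gt0. Qed.

Let low_orthant k : ((low k)%:E * mu (orthant k) =
  (c1 / (N%:R * expR 1) `^ gamma * vol1 * expR (k%:R * r))%:E)%E.
Proof.
rewrite /orthant lebesgue_rV_itv_box => [|i]; last exact/ltW/ltr_radius.
rewrite -EFinM; congr EFin.
transitivity (low k * (expR (k%:R * Q) * vol1)).
  congr (_ * _); rewrite /vol1 /Q mulr_sumr -expR_prod -big_split /=.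
  apply: eq_bigr => i _; rewrite /radius -natr1 mulrDl expRD mul1r.
  by ring.
rewrite /low; transitivity (c1 / (N%:R * expR 1) `^ gamma * vol1 *
  (expR (k%:R * (2 / beta j - gamma)) * expR (k%:R * Q))); first by ring.
by rewrite -expRD; congr (_ * expR _); rewrite /r; ring.
Qed.

(** For r >= 0 the disjoint cells from some index on all contribute at least the same constant C >
    0. *)
Lemma second_moment_infinite : 0 <= r ->
  (\int[mu]_(x in [set: 'rV[R]_N]) (x 0 j ^+ 2 * f x)%:E = +oo)%E.
Proof.
move=> r0.
(* K >= c3 beta_j gives e^{K/beta_j} >= 1 + K/beta_j >= c3, so the cells from K on lie where the
   bounds on f hold. *)
have [K c3K] : exists K, c3 <= radius K j.
  exists (Num.bound (c3 * beta j)); apply: le_trans (expR_ge1Dx _).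
  have := archi_boundP (mulr_ge0 (ltW c3_gt0) (ltW (beta_gt0 j))).
  by rewrite -ltr_pdivlMr// => /ltW/le_trans; apply; rewrite lerDr.
pose C := c1 / (N%:R * expR 1) `^ gamma * vol1.
have C0 : 0 < C.
  rewrite mulr_gt0// divr_gt0// powR_gt0// mulr_gt0 ?expR_gt0// ltr0n.
  exact: leq_ltn_trans (ltn_ord j).
have c3k k : c3 <= radius (K + k) j.
  apply: (le_trans c3K); rewrite ler_expR ler_pM2r ?invr_gt0//.
  by rewrite ler_nat leq_addr.
have orthant_ge k :
    (C%:E <= \int[mu]_(x in orthant (K + k)) (x 0 j ^+ 2 * f x)%:E)%E.
  apply: (@le_trans _ _ (\int[mu]_(x in orthant (K + k)) (cst (low (K + k))%:E x))%E).
    rewrite integral_cst// low_orthant lee_fin ler_peMr //; first exact: ltW.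
    rewrite -[leLHS]expR0 ler_expR.
    by rewrite mulr_ge0.
  apply: ge0_le_integral => //.
  - move=> x _; rewrite lee_fin.
    by rewrite !mulr_ge0 ?invr_ge0 ?powR_ge0 ?expR_ge0 ?ltW.
  - exact: measurable_funTS.
  - by move=> x xk; rewrite lee_fin coord_sqr_f_ge.
pose F k := orthant (K + k).
have bigcup_le : (\int[mu]_(x in \bigcup_k F k) (x 0 j ^+ 2 * f x)%:E <=
    \int[mu]_(x in [set: 'rV[R]_N]) (x 0 j ^+ 2 * f x)%:E)%E.
  by apply: ge0_subset_integral => //; apply: bigcupT_measurable => k; exact: morthant.
apply/eqP; rewrite -leye_eq; apply: le_trans bigcup_le.
rewrite ge0_integral_bigcup//; last 3 first.
- by move=> k; exact: morthant.
- exact: measurable_funTS.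
- by move=> k m _ _ km; exact: addnI (trivIset_orthant I I km).
apply: (@le_trans _ _ (\sum_(0 <= k <oo) C%:E)%E); last first.
  by apply: lee_nneseries => [k _ _|k _]; [rewrite lee_fin ltW|exact: orthant_ge].
(* A finite sum would force the constant terms C to tend to 0. *)
rewrite leNgt; apply/negP => /(nnseries_is_cvg (fun=> ltW C0))/cvg_series_cvg_0.
move=> /cvg_lim -/(_ (@Rhausdorff R)); rewrite lim_cst; last exact: Rhausdorff.
by move=> C_eq0; rewrite C_eq0 ltxx in C0.
Qed.

End anisotropic_integral.

Unset Implicit Arguments.

Theorem corollary4p3 (R : realType) (d : measure_display) (T : measurableType d)
  (P : probability T R) (N : nat) (X : 'rV[R]_N -> {RV P >-> R})
  (f : 'rV[R]_N -> R) (c1 c2 c3 gamma : R) (beta : 'I_N -> R)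
  (hgauss : gaussian_field X) (hcent : centered X)
  (hincr : stationary_increments X)
  (hX0 : {ae P, forall w, X 0 w = 0})
  (hcont : continuous_covariance X)
  (hf : spectral_density X f)
  (hc1 : 0 < c1) (hc2 : 0 < c2) (hc3 : 0 < c3) (hgamma : 0 < gamma)
  (hbeta : forall j, 0 < beta j)
  (hgb : \sum_(j < N) (beta j)^-1 < gamma)
  (hbound : forall x : 'rV[R]_N, c3 <= enorm x ->
     c1 / aniso_power beta gamma x <= f x <= c2 / aniso_power beta gamma x) :
  forall (j : 'I_N) (t : 'rV[R]_N),
    (ms_partial_exists X j t <->
       2 < beta j * (gamma - \sum_(i < N) (beta i)^-1)) /\
    (2 < beta j * (gamma - \sum_(i < N) (beta i)^-1) <->
       1 < hurst_index beta gamma j).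
Proof.
move=> j t; have b0 := hbeta j.
split; last by rewrite /hurst_index; split; lra.
have [f_ge0 _ mf f_weight _] := hf.
(* Division by beta_j > 0 turns the condition into negativity of the exponent r that decides the
   integral. *)
have criterion : 2 < beta j * (gamma - \sum_(i < N) (beta i)^-1) =
    (2 / beta j + \sum_(i < N) (beta i)^-1 - gamma < 0).
  by rewrite -addrA -[in RHS]opprB subr_lt0 ltr_pdivrMr// mulrC.
rewrite criterion; split=> [|r_lt0].
  move=> /(second_moment_of_ms_partial hgauss hf) x2f_lty; rewrite ltNge.
  apply/negP => /(second_moment_infinite mf f_ge0 hc1 hc3 hgamma hbeta hbound) x2f_y.
  by rewrite x2f_y in x2f_lty.
apply: (ms_partial_of_second_moment hgauss hf).
exact: (second_moment_lty mf f_ge0 f_weight hc2 hc3 hgamma hbeta hbound r_lt0).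
Qed.
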